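(* Let $\Omega=\Omega_{(1)}\times\dots\times\Omega_{(m)}$ with $\Omega_{(i)}\subset\mathbb R^{n_i}$ compact and convex. For $1\le i\le m$ let $\mathcal A^i$ be a method on $\Omega_{(i)}$ with $\mathrm{SB}_{\mathcal A^i}(\Omega_{(i)})=\tau_i>0$, and let $\tau^*=\min_{1\le i\le m}\tau_i$. 1. Assume that $d\in\mathcal A(x,g)$ if and only if for every $i\in[1:m]$ $$d_{(i)}=w_i\hat c_i\quad\text{with } c_i\in\mathcal A^i(x_{(i)},g_{(i)}),\quad w_i=\langle g_{(i)},\hat c_i\rangle .$$ Then $\mathrm{SB}_{\mathcal A}(\Omega)=\tau^*$. 2. Assume that $d\in\mathcal A(x,g)$ if and only if for every $i\in[1:m]$ $$d_{(i)}=w_i\hat c_i\quad\text{with } c_i\in\mathcal A^i(x_{(i)},g_{(i)}),\quad w_i\ge0,$$ for a weight vector $w\in\mathbb R^m\setminus\{0\}$ such that $$\mathrm{argmax}_{i\in[1:m]}w_i\ \cap\ \mathrm{argmax}_{i\in[1:m]}\langle g_{(i)},\hat c_i\rangle\neq\emptyset .$$ Then $\mathrm{SB}_{\mathcal A}(\Omega)\ge\frac{\tau^*}m$.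
   Context: For a block vector $x\in\mathbb R^n=\mathbb R^{n_1}\times\dots\times\mathbb R^{n_m}$, $x_{(i)}\in\mathbb R^{n_i}$ is its $i$-th block; $[1:m]=\{1,\dots,m\}$; $\hat c=c/\|c\|$ for $c\ne0$ and $\hat 0=0$. For a compact convex set $C$: $T_C(x)$ is the tangent cone at $x\in C$, $\pi(T_C(x),\cdot)$ the Euclidean projection on it, $\pi_x(g)=\|\pi(T_C(x),g)\|$. A method $\mathcal M$ on $C$ assigns to each $x\in C$ and vector $g$ a nonempty set $\mathcal M(x,g)\subset(T_C(x)\cap\{y:\langle g,y\rangle>0\})\cup\{0\}$ of directions, with $\mathcal M(x,g)=\{0\}$ if $\pi_x(g)=0$ and $0\notin\mathcal M(x,g)$ otherwise. $\mathrm{DSB}_{\mathcal M}(C,x,g)=\inf_{d\in\mathcal M(x,g)}\frac{\langle g,d\rangle}{\pi_x(g)\|d\|}$ if $\pi_x(g)\ne0$ and $=1$ otherwise; $\mathrm{SB}_{\mathcal M}(C)=\inf_{x\in C,\,g}\mathrm{DSB}_{\mathcal M}(C,x,g)$. These definitions are applied with $C=\Omega_{(i)}$, $\mathcal M=\mathcal A^i$ and with $C=\Omega$, $\mathcal M=\mathcal A$. *)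

(* Defs.v *)
From HB Require Import structures.
From mathcomp Require Import all_boot all_order all_algebra.
From mathcomp Require Import all_classical all_reals all_analysis.
Set Implicit Arguments.
Unset Strict Implicit.
Unset Printing Implicit Defensive.
Import Order.TTheory GRing.Theory Num.Theory numFieldNormedType.Exports.
Local Open Scope classical_set_scope.
Local Open Scope ring_scope.

(* The norm of MathComp-Analysis on ['rV[R]_n] is the sup norm, hence a
   separate Euclidean norm; both induce the same topology, so [compact] and
   [closure] on ['rV[R]_n] are the usual ones. *)
Definition dot (R : realType) (n : nat) (u v : 'rV[R]_n) : R :=
  \sum_(j < n) u ord0 j * v ord0 j.

Definition enorm (R : realType) (n : nat) (u : 'rV[R]_n) : R :=
  Num.sqrt (dot u u).

Definition hat (R : realType) (n : nat) (c : 'rV[R]_n) : 'rV[R]_n :=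
  if c == 0 then 0 else (enorm c)^-1 *: c.

(* Tangent cone of a convex set: closure of the cone of feasible directions. *)
Definition tangent_cone (R : realType) (n : nat) (C : set 'rV[R]_n)
    (x : 'rV[R]_n) : set 'rV[R]_n :=
  closure [set t *: (y - x) | t in [set t : R | 0 <= t] & y in C].

(* The default value 0 is never used for a nonempty closed convex [T], where
   the nearest point exists and is unique. *)
Definition eproj (R : realType) (n : nat) (T : set 'rV[R]_n) (g : 'rV[R]_n) :
    'rV[R]_n :=
  xget 0 [set p | T p /\ forall q, T q -> enorm (g - p) <= enorm (g - q)].

Definition proj_norm (R : realType) (n : nat) (C : set 'rV[R]_n)
    (x g : 'rV[R]_n) : R :=
  enorm (eproj (tangent_cone C x) g).

Definition is_method (R : realType) (n : nat) (C : set 'rV[R]_n)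
    (M : 'rV[R]_n -> 'rV[R]_n -> set 'rV[R]_n) : Prop :=
  forall x g, C x ->
  [/\ M x g !=set0,
      M x g `<=` (tangent_cone C x `&` [set y | 0 < dot g y]) `|` [set 0],
      proj_norm C x g = 0 -> M x g = [set 0] &
      proj_norm C x g <> 0 -> ~ M x g 0].

(* Infima are taken in the extended reals, so that [SB] is [+oo] when [C] is
   empty; in particular a finite value of [SB] entails that [C] is nonempty. *)
Definition DSB (R : realType) (n : nat)
    (M : 'rV[R]_n -> 'rV[R]_n -> set 'rV[R]_n) (C : set 'rV[R]_n)
    (x g : 'rV[R]_n) : \bar R :=
  if proj_norm C x g != 0 then
    ereal_inf [set (dot g d / (proj_norm C x g * enorm d))%:E | d in M x g]
  else 1%:E.

Definition SB (R : realType) (n : nat)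
    (M : 'rV[R]_n -> 'rV[R]_n -> set 'rV[R]_n) (C : set 'rV[R]_n) : \bar R :=
  ereal_inf [set DSB M C x g | x in C & g in [set: 'rV[R]_n]].

(* R^n = R^{n_1} x ... x R^{n_m} is ['rV[R]_(\sum_i n i)], and the i-th block of
   [x] is [submxrow x i]. *)
Definition block_prod (R : realType) (m : nat) (n : 'I_m -> nat)
    (Omega : forall i, set 'rV[R]_(n i)) : set 'rV[R]_(\sum_i n i) :=
  [set x | forall i, Omega i (submxrow x i)].

Definition argmax (R : realType) (m : nat) (f : 'I_m -> R) : set 'I_m :=
  [set i | forall j, f j <= f i].

(* Main.v *)
Require Import Defs.
From HB Require Import structures.
From mathcomp Require Import all_boot all_order all_algebra.
From mathcomp Require Import all_classical all_reals all_analysis.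
From mathcomp Require Import ring lra.
Set Implicit Arguments.
Unset Strict Implicit.
Unset Printing Implicit Defensive.
Import Order.TTheory GRing.Theory Num.Theory numFieldNormedType.Exports.
Local Open Scope classical_set_scope.
Local Open Scope ring_scope.

(** Why the bounds hold.  Fix a feasible x and a vector g, and write P_i for the
    norm of the projection of the block g_i on the tangent cone of Omega_i,
    and P for the one of g on the tangent cone of the product.

    Convexity makes the tangent cone of the product the product of the tangent
    cones ([tangent_cone_block]): feasible directions of the blocks, reached
    with different step lengths, can be reached with a common one by shortening
    the steps inside the convex blocks.  Projections are then computed block by
    block, so P^2 = \sum_i P_i^2 ([proj_norm_block]).

    Let a_i be the inner product of g_i with the unit vector of c_i, where c_i
    is a direction chosen by the i-th method.  A slope bound at least t
    says that t P_i <= a_i, also when P_i = 0, since then c_i = 0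
    ([SB_le_slope]).  Summing squares gives (t P)^2 <= \sum_i a_i^2
    ([sqr_proj_norm_le_slopes]).

    If the weights are w_i = a_i, then <g, d> = |d|^2 = \sum_i a_i^2, so
    <g, d> / |d| = |d| >= t P ([parallel_bound]).  The value tau* is not
    exceeded: taking g supported in a single block i, the other blocks are
    stationary and the product problem is the i-th problem
    ([parallel_SB_le]).

    If some block i0 maximizes both w and a, then <g, d> >= w_i0 a_i0, whereas
    |d|^2 <= m w_i0^2 and (t P)^2 <= m a_i0^2, so that
    t P |d| <= m <g, d> ([sequential_bound]). *)

(** * Euclidean inner product and norm *)

Section Euclid.
Context {R : realType} {n : nat}.
Implicit Types (u v g p : 'rV[R]_n) (a : R).

Lemma dotC u v : dot u v = dot v u.
Proof. by apply: eq_bigr => j _; rewrite mulrC. Qed.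

Lemma dotDl u v g : dot (u + v) g = dot u g + dot v g.
Proof. by rewrite -big_split; apply: eq_bigr => j _; rewrite mxE mulrDl. Qed.

Lemma dotZl a u v : dot (a *: u) v = a * dot u v.
Proof. by rewrite mulr_sumr; apply: eq_bigr => j _; rewrite mxE mulrA. Qed.

Lemma dotDr u v g : dot g (u + v) = dot g u + dot g v.
Proof. by rewrite dotC dotDl !(dotC _ g). Qed.

Lemma dotZr a u v : dot u (a *: v) = a * dot u v.
Proof. by rewrite dotC dotZl dotC. Qed.

Lemma dot0l v : dot 0 v = 0.
Proof. by rewrite -(scale0r 0) dotZl mul0r. Qed.

Lemma dot0r v : dot v 0 = 0.
Proof. by rewrite dotC dot0l. Qed.

Lemma dot_ge0 u : 0 <= dot u u.
Proof. by apply: sumr_ge0 => j _; rewrite -expr2 sqr_ge0. Qed.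

Lemma coord_le_dot u j : u ord0 j ^+ 2 <= dot u u.
Proof.
rewrite /dot (bigD1 j) //= expr2 lerDl.
by apply: sumr_ge0 => k _; rewrite -expr2 sqr_ge0.
Qed.

Lemma dot_eq0 u : (dot u u == 0) = (u == 0).
Proof.
apply/eqP/eqP => [u0|->]; last exact: dot0l.
apply/rowP => j; rewrite mxE; apply/eqP.
by rewrite -sqrf_eq0 eq_le sqr_ge0 andbT -u0 coord_le_dot.
Qed.

Lemma dot_gt0 u : (0 < dot u u) = (u != 0).
Proof. by rewrite lt0r dot_ge0 andbT dot_eq0. Qed.

Lemma enorm_ge0 u : 0 <= enorm u.
Proof. exact: sqrtr_ge0. Qed.

Lemma sqr_enorm u : enorm u ^+ 2 = dot u u.
Proof. by rewrite sqr_sqrtr ?dot_ge0. Qed.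

Lemma enorm_gt0 u : (0 < enorm u) = (u != 0).
Proof. by rewrite sqrtr_gt0 dot_gt0. Qed.

Lemma enorm_le u v : (enorm u <= enorm v) = (dot u u <= dot v v).
Proof. by rewrite ler_psqrt // nnegrE dot_ge0. Qed.

Lemma hat0 : hat (0 : 'rV[R]_n) = 0.
Proof. by rewrite /hat eqxx. Qed.

Lemma dot_hat u v : dot u (hat v) = dot u v / enorm v.
Proof.
rewrite /hat; case: eqP => [->|_]; last by rewrite dotZr mulrC.
by rewrite !dot0r mul0r.
Qed.

Lemma dot_hat_hat u : dot (hat u) (hat u) = (u != 0)%:R.
Proof.
have [->|u0] := eqVneq u 0; first by rewrite hat0 dot0l.
rewrite dot_hat /hat (negPf u0) dotZl -sqr_enorm /=.
by field; rewrite gt_eqF ?enorm_gt0.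
Qed.

(** The topology of row vectors comes from the sup norm, hence closeness may be
    tested coordinate by coordinate. *)
Lemma closure_rowP (S : set 'rV[R]_n) v :
  closure S v <->
  forall e : R, 0 < e -> exists2 s, S s & forall j, `|v ord0 j - s ord0 j| < e.
Proof.
split=> [clv e e0|H B /nbhs_ballP [e /= e0 eB]].
  have [|s [Ss [_ vs]]] := clv (ball v e); first exact: nbhsx_ballx.
  by exists s => // j; exact: vs.
have [s Ss vs] := H e e0; exists s; split => //; apply: eB; split => // i j.
by rewrite (ord1 i); exact: vs.
Qed.

End Euclid.

(** * Nearest points of closed cones *)

Section Nearest.
Context {R : realType} {n : nat}.
Implicit Types (g p q v : 'rV[R]_n) (a : R).

Definition nearest (T : set 'rV[R]_n) g p :=
  T p /\ forall q, T q -> enorm (g - p) <= enorm (g - q).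

Definition is_cone (T : set 'rV[R]_n) :=
  forall a v, 0 <= a -> T v -> T (a *: v).

Lemma continuous_dist g : continuous (fun q : 'rV[R]_n => dot (g - q) (g - q)).
Proof.
rewrite /dot; apply: (@continuous_big R 'I_n +%R 0 xpredT) => [|j _ q].
  exact: add_continuous.
have c : {for q, continuous (fun q' : 'rV[R]_n => g ord0 j - q' ord0 j)}.
  by apply: continuousB; [exact: cst_continuous|exact: coord_continuous].
under eq_fun do rewrite !mxE.
exact: (continuousM c c).
Qed.

Lemma dot_sqrB g p : dot (g - p) (g - p) = dot g g - 2 * dot g p + dot p p.
Proof.
by rewrite -scaleN1r !(dotDl, dotDr, dotZl, dotZr) (dotC p g); ring.
Qed.

(** On the ray through a nearest point p, which lies in the cone, the quadratic
    a |-> |g - a p|^2 is smallest at a = 1; comparing this value with the one at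
    its vertex a = <g, p> / |p|^2 forces <g, p> = |p|^2. *)
Lemma nearest_cone_dot (T : set 'rV[R]_n) g p :
  is_cone T -> nearest T g p -> dot g p = dot p p.
Proof.
move=> cT [Tp pmin].
have ineq a : 0 <= a ->
    - 2 * dot g p + dot p p <= - 2 * a * dot g p + a ^+ 2 * dot p p.
  move=> a0; have := pmin _ (cT _ _ a0 Tp).
  by rewrite enorm_le !dot_sqrB !(dotZl, dotZr); lra.
have [->|p0] := eqVneq p 0; first by rewrite !dot0r.
have b0 : 0 < dot p p by rewrite dot_gt0.
(* comparison with a = 0: the vertex of the parabola lies on the ray *)
have gp0 : 0 <= dot g p by have := ineq 0 (lexx _); lra.
have := ineq (dot g p / dot p p) (divr_ge0 gp0 (ltW b0)).
set a := dot g p; set b := dot p p.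
have -> : - 2 * (a / b) * a + (a / b) ^+ 2 * b = - (a ^+ 2 / b).
  by field; rewrite gt_eqF.
rewrite -subr_ge0 => le0; apply/eqP; rewrite -subr_eq0 -sqrf_eq0 eq_le sqr_ge0.
rewrite andbT -(pmulr_rle0 _ (_ : 0 < b^-1)) ?invr_gt0 //.
have -> : b^-1 * (a - b) ^+ 2 = - (- (a ^+ 2 / b) - (- 2 * a + b)).
  by field; rewrite gt_eqF.
by rewrite oppr_le0.
Qed.

(** By orthogonality |p|^2 = |g|^2 - |g - p|^2, so the norm of a nearest point
    is determined by the distance from g to the cone: the norm of the projection
    can be read off any nearest point, whichever one [eproj] selects. *)
Lemma nearest_cone_norm (T : set 'rV[R]_n) g p q :
  is_cone T -> nearest T g p -> nearest T g q -> dot p p = dot q q.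
Proof.
move=> cT np nq; have := np.2 _ nq.1; have := nq.2 _ np.1.
rewrite !enorm_le !dot_sqrB (nearest_cone_dot cT np) (nearest_cone_dot cT nq).
by lra.
Qed.

(** The points of T at distance at most r = |g - q0| from g lie in the compact
    box of half-width r around g, where the distance attains its minimum. *)
Lemma nearest_exists (T : set 'rV[R]_n) g :
  closed T -> T !=set0 -> exists p, nearest T g p.
Proof.
move=> clT [q0 Tq0]; pose r := enorm (g - q0).
pose side j := `[g ord0 j - r, g ord0 j + r]%classic.
pose box := [set q : 'rV[R]_n | forall j, side j (q ord0 j)].
have inbox q : enorm (g - q) <= r -> box q.
  move=> qr j; rewrite /side /= in_itv /= -ler_distlC; apply: le_trans qr.
  rewrite -ler_sqr ?nnegrE ?enorm_ge0 // sqr_enorm real_normK ?num_real //.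
  by have := coord_le_dot (g - q) j; rewrite !mxE.
have cK : compact (T `&` box).
  rewrite setIC; apply: compact_closedI => //.
  by apply: (@rV_compact _ _ side) => j; exact: segment_compact.
pose dist q := dot (g - q) (g - q).
have [||p] := @compact_EVT_min _ _ dist _ _ cK.
- by exists q0; split => //; exact: inbox.
- by apply: continuous_subspaceT; exact: continuous_dist.
rewrite inE => -[Tp _] pmin; exists p; split => // q Tq.
have [qr|/ltW rq] := leP (enorm (g - q)) r.
  by rewrite enorm_le pmin // inE; split => //; exact: inbox.
apply: le_trans rq; rewrite enorm_le pmin // inE; split => //; exact: inbox.
Qed.

Lemma eproj_nearest (T : set 'rV[R]_n) g :
  closed T -> T !=set0 -> nearest T g (eproj T g).
Proof. by move=> clT T0; exact: (xgetPex 0 (nearest_exists g clT T0)). Qed.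

End Nearest.

(** * Tangent cones and the norm of the projected vector *)

Section Tangent.
Context {R : realType} {n : nat}.
Context (C : set 'rV[R]_n) (x : 'rV[R]_n) (Cx : C x).

Lemma tangent_coneP v : tangent_cone C x v <->
  forall e : R, 0 < e -> exists t y, [/\ 0 <= t, C y &
    forall j, `|v ord0 j - t * (y - x) ord0 j| < e].
Proof.
split=> [/closure_rowP H e /H [_ [t t0 [y Cy <-]] ve]|H].
  by exists t, y; split => // j; have := ve j; rewrite mxE.
apply/closure_rowP => e /H [t [y [t0 Cy ve]]].
by exists (t *: (y - x)) => [|j]; [exists t => //; exists y|rewrite mxE].
Qed.

Lemma tangent_cone0 : tangent_cone C x 0.
Proof.
apply/tangent_coneP => e e0; exists 0, x; split => // j.
by rewrite subrr !mxE mulr0 subr0 normr0.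
Qed.

(** Scaling by a also scales the error of an approximating feasible direction;
    the tolerance e / (a + 1) covers a = 0 as well. *)
Lemma tangent_cone_is_cone : is_cone (tangent_cone C x).
Proof.
move=> a v a0 /tangent_coneP vT; apply/tangent_coneP => e e0.
have a1 : 0 < a + 1 by lra.
have [t [y [t0 Cy ve]]] := vT _ (divr_gt0 e0 a1).
exists (a * t), y; split => [||j] //; first exact: mulr_ge0.
rewrite mxE -mulrA -mulrBr normrM (ger0_norm a0).
have := ve j; rewrite ltr_pdivlMr // => h.
apply: le_lt_trans h; rewrite mulrC ler_wpM2l //; lra.
Qed.

Lemma proj_norm_nearest g p :
  nearest (tangent_cone C x) g p -> proj_norm C x g ^+ 2 = dot p p.
Proof.
move=> np; rewrite sqr_enorm.
apply: nearest_cone_norm tangent_cone_is_cone _ np.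
by apply: eproj_nearest; [exact: closed_closure|exists 0; exact: tangent_cone0].
Qed.

Lemma proj_norm_ge0 g : 0 <= proj_norm C x g.
Proof. exact: enorm_ge0. Qed.

Lemma proj_norm0 : proj_norm C x 0 = 0.
Proof.
apply/eqP; rewrite -sqrf_eq0 (@proj_norm_nearest _ 0) ?dot0l //; split=> [|q _].
  exact: tangent_cone0.
by rewrite subrr enorm_le dot0l dot_ge0.
Qed.

Lemma nearest_tangent_exists g : exists p, nearest (tangent_cone C x) g p.
Proof.
apply: nearest_exists; first exact: closed_closure.
by exists 0; exact: tangent_cone0.
Qed.

End Tangent.

(** * Products of convex sets *)

Section Blocks.
Context {R : realType} {m : nat} {n : 'I_m -> nat}.
Implicit Types (x g d v : 'rV[R]_(\sum_i n i)).

Lemma dot_block v g : dot v g = \sum_i dot (submxrow v i) (submxrow g i).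
Proof.
have dotE k (a b : 'rV[R]_k) : dot a b = (a *m b^T) ord0 ord0.
  by rewrite mxE; apply: eq_bigr => j _; rewrite mxE.
rewrite dotE -{1}[v]submxrowK -{1}[g]submxrowK tr_mxrow mul_mxrow_mxcol.
by rewrite summxE; apply: eq_bigr => i _; rewrite dotE.
Qed.

Lemma submxrow_coord v i j : submxrow v i ord0 j = v ord0 (tagnat.Rank i j).
Proof. by rewrite mxE. Qed.

Lemma convex_segment k (C : set 'rV[R]_k) (a b : 'rV[R]_k) (s : R) :
  convex_set C -> 0 <= s -> s <= 1 -> C a -> C b -> C (a + s *: (b - a)).
Proof.
move=> cC s0 s1 Ca Cb; have := cC b a (Itv01 s0 s1).
rewrite !inE => /(_ Cb Ca).
by rewrite scalerBr addrCA -[X in X - s *: a]scale1r -scalerBl.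
Qed.

(** The feasible directions t_i (y_i - x_i) of the blocks have unrelated step
    lengths.  Moving y_i to x_i + (t_i / s) (y_i - x_i), which stays in the
    convex set as soon as t_i <= s, gives them the common step length s. *)
Lemma tangent_cone_block (Omega : forall i, set 'rV[R]_(n i)) x v :
  (forall i, convex_set (Omega i)) -> block_prod Omega x ->
  tangent_cone (block_prod Omega) x v <->
  forall i, tangent_cone (Omega i) (submxrow x i) (submxrow v i).
Proof.
move=> cO Ox; split=> [/tangent_coneP vT i|vT]; apply/tangent_coneP => e e0.
  have [t [y [t0 Oy ve]]] := vT e e0.
  exists t, (submxrow y i); split => // j; have := ve (tagnat.Rank i j).
  by rewrite !mxE.
have /fin_all_exists [t /fin_all_exists [y ty]] i : exists t y,
    [/\ 0 <= t, Omega i y &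
    forall j, `|submxrow v i ord0 j - t * (y - submxrow x i) ord0 j| < e].
  by apply: (tangent_coneP _ _ _).1 => //; exact: vT.
(* any positive common upper bound of the t_i would do *)
pose s := 1 + \sum_i t i.
have t0 i : 0 <= t i by have [] := ty i.
have s0 : 0 < s by rewrite /s ltr_pwDl // sumr_ge0.
have ts i : t i <= s.
  by rewrite /s (bigD1 i) //= addrCA lerDl addr_ge0 // sumr_ge0.
exists s, (\mxrow_i (submxrow x i + (t i / s) *: (y i - submxrow x i))).
split => [|i|k]; first exact: ltW.
  rewrite mxrowK; apply: convex_segment (Ox i) _ => //.
  - exact: divr_ge0 (t0 i) (ltW s0).
  - by rewrite ler_pdivrMr // mul1r.
  - by have [] := ty i.
rewrite -(tagnat.sig2K k); move: (tagnat.sig1 k) (tagnat.sig2 k) => i j.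
rewrite -!submxrow_coord submxrowB mxrowK addrAC subrr add0r [X in s * X]mxE.
have [_ _ /(_ j)] := ty i; congr (`|_ - _| < e).
by field; rewrite gt_eqF.
Qed.

(** The nearest points of the blocks assemble into a nearest point of the
    product, because squared distances add up over the blocks. *)
Lemma proj_norm_block (Omega : forall i, set 'rV[R]_(n i)) x g :
  (forall i, convex_set (Omega i)) -> block_prod Omega x ->
  proj_norm (block_prod Omega) x g ^+ 2 =
  \sum_i proj_norm (Omega i) (submxrow x i) (submxrow g i) ^+ 2.
Proof.
move=> cO Ox.
have /fin_all_exists [p np] i := nearest_tangent_exists (Ox i) (submxrow g i).
rewrite (@proj_norm_nearest _ _ _ _ Ox _ (\mxrow_i p i)).
  rewrite dot_block; apply: eq_bigr => i _.
  by rewrite mxrowK (proj_norm_nearest (Ox i) (np i)).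
split=> [|q Tq].
  by apply/tangent_cone_block => // i; rewrite mxrowK; case: (np i).
rewrite enorm_le !dot_block; apply: ler_sum => i _.
rewrite !submxrowB mxrowK -enorm_le; apply: (np i).2.
by move/tangent_cone_block: Tq; exact.
Qed.

End Blocks.

(** * Slope bounds of a single method *)

Section SlopeBound.
Context {R : realType} {n : nat}.
Context {C : set 'rV[R]_n} {M : 'rV[R]_n -> 'rV[R]_n -> set 'rV[R]_n}.
Implicit Types (x g c d : 'rV[R]_n) (t : R).

(** Over an empty set the infimum is infinite. *)
Lemma SB_nonempty t : SB M C = t%:E -> C !=set0.
Proof.
move=> SBt; apply/set0P; apply/eqP => C0; move: SBt; rewrite /SB.
suff -> : [set DSB M C x g | x in C & g in [set: 'rV[R]_n]] = set0.
  by rewrite ereal_inf0.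
by apply/seteqP; split=> // u [x]; rewrite C0.
Qed.

Lemma SB_le_DSB x g : C x -> (SB M C <= DSB M C x g)%E.
Proof. by move=> Cx; apply: ereal_inf_lbound; exists x => //; exists g. Qed.

(** The vector g = 0 contributes the conventional value 1 to the infimum. *)
Lemma SB_le1 x : C x -> (SB M C <= 1%:E)%E.
Proof.
by move=> Cx; have := SB_le_DSB 0 Cx; rewrite /DSB proj_norm0 // eqxx.
Qed.

(** Clearing the denominator in the slope is legitimate because <g, d> > 0
    excludes d = 0, for which the quotient would be 0. *)
Lemma SB_ge t : t <= 1 ->
  (forall x g d, C x -> proj_norm C x g != 0 -> M x g d ->
     0 < dot g d /\ t * (proj_norm C x g * enorm d) <= dot g d) ->
  (t%:E <= SB M C)%E.
Proof.
move=> t1 H; apply: le_ereal_inf_tmp => _ [x Cx [g _ <-]]; rewrite /DSB.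
case: ifP => [P0|_]; last by rewrite lee_fin.
apply: le_ereal_inf_tmp => _ [d Md <-]; rewrite lee_fin.
have [gd0 le] := H _ _ _ Cx P0 Md.
have d0 : d != 0 by apply: contraTneq gd0 => ->; rewrite dot0r ltxx.
have P_gt0 : 0 < proj_norm C x g by rewrite lt0r P0 proj_norm_ge0.
by rewrite ler_pdivlMr // mulr_gt0 ?(enorm_gt0 d).
Qed.

Hypothesis methodM : is_method C M.

Lemma method_stationary x g : C x -> proj_norm C x g = 0 -> M x g = [set 0].
Proof. by move=> Cx P0; have [_ _ ->] := methodM g Cx. Qed.

(** Stated without a quotient, the slope bound also covers the stationary case,
    where c = 0 and both sides vanish. *)
Lemma SB_le_slope t x g c : (t%:E <= SB M C)%E -> C x -> M x g c ->
  t * proj_norm C x g <= dot g (hat c).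
Proof.
move=> tSB Cx Mc; have [_ _ M0 Mn0] := methodM g Cx.
have [P0|P0] := eqVneq (proj_norm C x g) 0.
  by move: Mc; rewrite M0 // => ->; rewrite P0 mulr0 hat0 dot0r.
have c0 : c != 0 by apply/eqP => c0; apply: Mn0; [exact/eqP|rewrite -c0].
have := le_trans tSB (SB_le_DSB g Cx); rewrite /DSB P0 => /le_trans tle.
have /tle : (ereal_inf [set (dot g d / (proj_norm C x g * enorm d))%:E
    | d in M x g] <= (dot g c / (proj_norm C x g * enorm c))%:E)%E.
  by apply: ereal_inf_lbound; exists c.
have Pgt : 0 < proj_norm C x g by rewrite lt0r P0 proj_norm_ge0.
by rewrite lee_fin invfM mulrCA -dot_hat [leRHS]mulrC ler_pdivlMr.
Qed.

End SlopeBound.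

(** * Lower bounds for the product *)

Section Product.
Context {R : realType} {m : nat} {n : 'I_m -> nat}.
Context {Omega : forall i : 'I_m, set 'rV[R]_(n i)}.
Context {Ai : forall i : 'I_m,
  'rV[R]_(n i) -> 'rV[R]_(n i) -> set 'rV[R]_(n i)}.
Context {t : R}.
Arguments Omega : clear implicits.
Arguments Ai : clear implicits.
Hypothesis hconvex : forall i, convex_set (Omega i).
Hypothesis hmethod : forall i, is_method (Omega i) (Ai i).
Arguments hmethod : clear implicits.
Implicit Types (x g d : 'rV[R]_(\sum_i n i)) (w : 'I_m -> R).
Implicit Types (c : forall i, 'rV[R]_(n i)).

Lemma dot_weighted g d c w :
  (forall i, submxrow d i = w i *: hat (c i)) ->
  dot g d = \sum_i w i * dot (submxrow g i) (hat (c i)).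
Proof.
by move=> dE; rewrite dot_block; apply: eq_bigr => i _; rewrite dE dotZr.
Qed.

(** The unit vector of a zero block is zero, hence the indicator. *)
Lemma sqr_enorm_weighted d c w :
  (forall i, submxrow d i = w i *: hat (c i)) ->
  enorm d ^+ 2 = \sum_i w i ^+ 2 * (c i != 0)%:R.
Proof.
move=> dE; rewrite sqr_enorm dot_block; apply: eq_bigr => i _.
by rewrite dE dotZl dotZr dot_hat_hat mulrA expr2.
Qed.

Hypothesis t_gt0 : 0 < t.
Hypothesis tSB : forall i, (t%:E <= SB (Ai i) (Omega i))%E.

Lemma block_slope_ge0 x g c i : block_prod Omega x ->
  Ai i (submxrow x i) (submxrow g i) (c i) ->
  0 <= dot (submxrow g i) (hat (c i)).
Proof.
move=> Ox Ac; apply: le_trans (SB_le_slope (hmethod i) (tSB i) (Ox i) Ac).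
by rewrite mulr_ge0 ?(ltW t_gt0) // proj_norm_ge0.
Qed.

Lemma sqr_proj_norm_le_slopes x g c : block_prod Omega x ->
  (forall i, Ai i (submxrow x i) (submxrow g i) (c i)) ->
  (t * proj_norm (block_prod Omega) x g) ^+ 2 <=
  \sum_i dot (submxrow g i) (hat (c i)) ^+ 2.
Proof.
move=> Ox Ac; rewrite exprMn proj_norm_block // mulr_sumr.
apply: ler_sum => i _; rewrite -exprMn ler_sqr ?nnegrE.
- exact: SB_le_slope (tSB i) (Ox i) (Ac i).
- by rewrite mulr_ge0 ?(ltW t_gt0) // proj_norm_ge0.
- exact: block_slope_ge0 (Ac i).
Qed.

(** With slopes as weights d satisfies <g, d> = |d|^2, so its slope <g, d> / |d|
    is |d|, the Euclidean norm of the vector of slopes. *)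
Lemma parallel_bound x g d c : block_prod Omega x ->
  proj_norm (block_prod Omega) x g != 0 ->
  (forall i, Ai i (submxrow x i) (submxrow g i) (c i)) ->
  (forall i, submxrow d i = dot (submxrow g i) (hat (c i)) *: hat (c i)) ->
  0 < dot g d /\ t * (proj_norm (block_prod Omega) x g * enorm d) <= dot g d.
Proof.
move=> Ox P0 Ac dE; have le := sqr_proj_norm_le_slopes Ox Ac.
have tP0 : 0 < t * proj_norm (block_prod Omega) x g.
  by rewrite mulr_gt0 // lt0r P0 proj_norm_ge0.
have gdE : dot g d = \sum_i dot (submxrow g i) (hat (c i)) ^+ 2.
  by rewrite (dot_weighted _ dE); apply: eq_bigr => i _; rewrite expr2.
have ddE : dot g d = enorm d ^+ 2.
  rewrite gdE (sqr_enorm_weighted dE); apply: eq_bigr => i _.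
  have [->|_] := eqVneq (c i) 0; last by rewrite mulr1.
  by rewrite hat0 dot0r expr0n mul0r.
split; first by rewrite gdE; apply: lt_le_trans le; rewrite exprn_gt0.
rewrite mulrA ddE expr2 ler_wpM2r ?enorm_ge0 //.
by rewrite -ler_sqr ?nnegrE ?enorm_ge0 ?(ltW tP0) // -ddE gdE.
Qed.

(** One block realizes both the largest weight and the largest slope, so its
    contribution to <g, d> alone dominates |d| / sqrt m times t P / sqrt m. *)
Lemma sequential_bound x g d c w i0 : block_prod Omega x ->
  proj_norm (block_prod Omega) x g != 0 ->
  (forall i, Ai i (submxrow x i) (submxrow g i) (c i)) ->
  (forall i, 0 <= w i) -> (exists i, w i != 0) ->
  (forall i, submxrow d i = w i *: hat (c i)) ->
  argmax w i0 -> argmax (fun i => dot (submxrow g i) (hat (c i))) i0 ->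
  0 < dot g d /\
  t / m%:R * (proj_norm (block_prod Omega) x g * enorm d) <= dot g d.
Proof.
move=> Ox P0 Ac w0 [i1 wi1] dE wmax amax.
set P := proj_norm _ _ _ in P0 *; have le := sqr_proj_norm_le_slopes Ox Ac.
set a := fun i => dot (submxrow g i) (hat (c i)) in amax le.
have a0 i : 0 <= a i := block_slope_ge0 Ox (Ac i).
have tP0 : 0 < t * P by rewrite mulr_gt0 // lt0r P0 proj_norm_ge0.
have m0 : 0 < m%:R :> R by rewrite ltr0n (leq_ltn_trans _ (ltn_ord i0)).
have sum_le (f : 'I_m -> R) :
    (forall i, f i <= f i0) -> \sum_i f i <= m%:R * f i0.
  move=> fle; apply: le_trans (ler_sum _ (fun i _ => fle i)) _.
  by rewrite sumr_const card_ord mulr_natl.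
have leP : (t * P) ^+ 2 <= m%:R * a i0 ^+ 2.
  apply: le_trans le _; apply: (sum_le (fun i => a i ^+ 2)) => i.
  by rewrite ler_sqr ?nnegrE.
have led : enorm d ^+ 2 <= m%:R * w i0 ^+ 2.
  rewrite (sqr_enorm_weighted dE).
  apply: le_trans (sum_le (fun i => w i ^+ 2) _) => [|i]; last first.
    by rewrite ler_sqr ?nnegrE.
  by apply: ler_sum => i _; rewrite ler_piMr ?sqr_ge0 // lern1 leq_b1.
have legd : w i0 * a i0 <= dot g d.
  rewrite (dot_weighted _ dE) (bigD1 i0) //= lerDl.
  by apply: sumr_ge0 => i _; exact: (mulr_ge0 (w0 i) (a0 i)).
(* if the largest slope were 0, then so would be t P *)
have ai0 : 0 < a i0.
  rewrite lt0r a0 andbT; apply: contraTneq leP => ->.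
  by rewrite expr0n /= mulr0 -ltNge exprn_gt0.
have wi0 : 0 < w i0 by apply: lt_le_trans (wmax i1); rewrite lt0r wi1 w0.
split; first by apply: lt_le_trans legd; exact: mulr_gt0.
apply: le_trans legd; rewrite mulrAC ler_pdivrMr // mulrA.
rewrite -ler_sqr ?nnegrE ?mulr_ge0 ?enorm_ge0 ?(ltW wi0) ?(ltW tP0) //;
  last exact: ltW.
rewrite exprMn.
apply: le_trans (ler_pM (sqr_ge0 _) (sqr_ge0 _) leP led) _.
by rewrite le_eqVlt; apply/orP; left; apply/eqP; ring.
Qed.

End Product.

(** * Sharpness of the parallel bound *)

(** A vector g supported in block i reduces the product to its i-th factor:
    the other blocks are stationary, their only direction is 0, and every
    slope of the i-th method occurs as a slope of the product.  The remaining
    blocks of the point x may be arbitrary, which is where all factors have to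
    be nonempty. *)
Lemma parallel_SB_le (R : realType) (m : nat) (n : 'I_m -> nat)
  (Omega : forall i : 'I_m, set 'rV[R]_(n i))
  (Ai : forall i : 'I_m, 'rV[R]_(n i) -> 'rV[R]_(n i) -> set 'rV[R]_(n i))
  (A : 'rV[R]_(\sum_i n i) -> 'rV[R]_(\sum_i n i) ->
    set 'rV[R]_(\sum_i n i)) i :
  (forall i, convex_set (Omega i)) ->
  (forall i, is_method (Omega i) (Ai i)) ->
  (forall i, Omega i !=set0) ->
  (forall x g d, block_prod Omega x ->
    (forall i, exists c, Ai i (submxrow x i) (submxrow g i) c /\
       submxrow d i = dot (submxrow g i) (hat c) *: hat c) -> A x g d) ->
  (SB A (block_prod Omega) <= SB (Ai i) (Omega i))%E.
Proof.
move=> cO mO /fin_all_exists [y Oy] hA.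
apply: le_ereal_inf_tmp => _ [xi Oxi [gi _ <-]].
pose x := \mxrow_j dfwith y i xi j.
pose g := \mxrow_j dfwith (fun j => 0 : 'rV[R]_(n j)) i gi j.
have xE : submxrow x i = xi by rewrite mxrowK dfwithin.
have gE : submxrow g i = gi by rewrite mxrowK dfwithin.
have gE0 j : i != j -> submxrow g j = 0 by move=> ij; rewrite mxrowK dfwithout.
have Ox : block_prod Omega x.
  move=> j; have [<-|ij] := eqVneq i j; first by rewrite xE.
  by rewrite mxrowK dfwithout.
have PE : proj_norm (block_prod Omega) x g = proj_norm (Omega i) xi gi.
  apply/eqP; rewrite -(eqrXn2 (ltn0Sn 1)) ?proj_norm_ge0 //.
  rewrite proj_norm_block // (bigD1 i) //=.
  rewrite xE gE big1 ?addr0 // => j; rewrite eq_sym => ij.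
  by rewrite gE0 // proj_norm0 // expr0n.
apply: le_trans (SB_le_DSB g Ox) _; rewrite /DSB PE; case: ifP => // P0.
apply: le_ereal_inf_tmp => _ [c Ac <-].
pose w := dot gi (hat c).
pose d := \mxrow_j dfwith (fun j => 0 : 'rV[R]_(n j)) i (w *: hat c) j.
have dE : submxrow d i = w *: hat c by rewrite mxrowK dfwithin.
have dE0 j : i != j -> submxrow d j = 0 by move=> ij; rewrite mxrowK dfwithout.
have Ad : A x g d.
  apply: hA => // j; have [<-|ij] := eqVneq i j.
    by exists c; rewrite xE gE dE.
  exists 0; rewrite gE0 // dE0 // hat0 scaler0; split => //.
  by rewrite (method_stationary (mO j)) // proj_norm0.
apply: ereal_inf_lbound; exists d => //; congr (_%:E).
have c0 : c != 0.
  have [_ _ _ Mn0] := mO i _ gi Oxi.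
  by apply/eqP => c0; apply: Mn0; [exact/eqP|rewrite -c0].
have w0 : 0 < w.
  have [_ /(_ _ Ac)] := mO i _ gi Oxi.
  case=> [[_ /= gc]|/= c0']; last by rewrite c0' eqxx in c0.
  by rewrite /w dot_hat divr_gt0 ?enorm_gt0.
have dd : dot d d = w ^+ 2.
  rewrite dot_block (bigD1 i) //= big1 => [|j ij]; last first.
    by rewrite dE0 1?eq_sym // dot0l.
  by rewrite dE dotZl dotZr dot_hat_hat c0 addr0 mulr1 expr2.
have gd : dot g d = w ^+ 2.
  rewrite dot_block (bigD1 i) //= big1 => [|j ij]; last first.
    by rewrite dE0 1?eq_sym // dot0r.
  by rewrite dE gE dotZr addr0 expr2.
rewrite gd (_ : enorm d = w); last by rewrite /enorm dd sqrtr_sqr gtr0_norm.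
rewrite (_ : dot gi c = w * enorm c); last first.
  by rewrite /w dot_hat divfK // gt_eqF ?enorm_gt0.
by field; rewrite P0 !gt_eqF ?enorm_gt0.
Qed.

(** * The two product methods *)

Theorem proposition6p6 (R : realType) (m : nat) (n : 'I_m.+1 -> nat)
    (Omega : forall i : 'I_m.+1, set 'rV[R]_(n i))
    (hcompact : forall i, compact (Omega i))
    (hconvex : forall i, convex_set (Omega i))
    (Ai : forall i : 'I_m.+1, 'rV[R]_(n i) -> 'rV[R]_(n i) -> set 'rV[R]_(n i))
    (hmethod : forall i, is_method (Omega i) (Ai i))
    (tau : 'I_m.+1 -> R)
    (hSB : forall i, SB (Ai i) (Omega i) = (tau i)%:E)
    (htau : forall i, 0 < tau i) :
  let taustar : R := \big[Order.min/tau ord0]_(i < m.+1) tau i in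
  (forall A : 'rV[R]_(\sum_i n i) -> 'rV[R]_(\sum_i n i) ->
      set 'rV[R]_(\sum_i n i),
    (forall x g d, block_prod Omega x ->
      (A x g d <->
       forall i, exists c : 'rV[R]_(n i), exists w : R,
         [/\ Ai i (submxrow x i) (submxrow g i) c,
             w = dot (submxrow g i) (hat c) &
             submxrow d i = w *: hat c])) ->
    SB A (block_prod Omega) = taustar%:E)
  /\
  (forall A : 'rV[R]_(\sum_i n i) -> 'rV[R]_(\sum_i n i) ->
      set 'rV[R]_(\sum_i n i),
    (forall x g d, block_prod Omega x ->
      (A x g d <->
       exists (c : forall i, 'rV[R]_(n i)) (w : 'rV[R]_m.+1),
         [/\ w != 0,
             forall i, [/\ Ai i (submxrow x i) (submxrow g i) (c i),
                           0 <= w ord0 i &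
                           submxrow d i = w ord0 i *: hat (c i)] &
             argmax (fun i => w ord0 i)
               `&` argmax (fun i => dot (submxrow g i) (hat (c i)))
               !=set0])) ->
    ((taustar / m.+1%:R)%:E <= SB A (block_prod Omega))%E).
Proof.
move=> taustar.
have ts_le i : taustar <= tau i by exact: bigmin_le.
have ts_gt0 : 0 < taustar by apply/bigmin_gtP; split.
have tsSB i : (taustar%:E <= SB (Ai i) (Omega i))%E by rewrite hSB lee_fin.
have O0 i : Omega i !=set0 := SB_nonempty (hSB i).
have ts_le1 : taustar <= 1.
  have [x Ox] := O0 ord0; rewrite -lee_fin; apply: le_trans (tsSB ord0) _.
  exact: SB_le1 Ox.
split=> A hA.
  apply/eqP; rewrite eq_le; apply/andP; split.
    have [i ->] : exists i, taustar = tau i.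
      apply: (big_ind (fun v => exists i, v = tau i)).
      - by exists ord0.
      - by move=> _ _ [i ->] [j ->]; case: leP => _; [exists i|exists j].
      - by move=> i _; exists i.
    rewrite -hSB; apply: parallel_SB_le => // x g d Ox H; apply/hA => // j.
    have [c [Ac dc]] := H j.
    by exists c, (dot (submxrow g j) (hat c)).
  apply: SB_ge => // x g d Ox P0 /(hA _ _ _ Ox).
  move=> /fin_all_exists [c /fin_all_exists [w H]].
  apply: (parallel_bound hconvex hmethod ts_gt0 tsSB Ox P0 (c := c)) => i.
    by have [] := H i.
  by have [_ <- ->] := H i.
apply: SB_ge => [|x g d Ox P0 /(hA _ _ _ Ox) [c [w [w0 H [i0 [wmax amax]]]]]].
  by rewrite ler_pdivrMr ?ltr0n // mul1r (le_trans ts_le1) // ler1n.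
apply: (sequential_bound hconvex hmethod ts_gt0 tsSB Ox P0 (c := c)
  _ _ _ _ wmax amax).
- by move=> i; have [] := H i.
- by move=> i; have [] := H i.
- by have /rV0Pn := w0.
- by move=> i; have [] := H i.
Qed.
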